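(* Let $p\ge5$ be a prime with Legendre symbol $\left(\frac{-21}{p}\right)=-1$. (1) For all integers $n,\alpha,\beta\ge0$, $$p_{7,7}\left(2 \cdot 7^{2 \alpha+1} p^{2 \beta} n+\frac{(11+12 r) \cdot 49^{\alpha} p^{2 \beta}-5}{6}\right) \equiv 0\pmod 2$$ and $$p_{7,7}\left(2 \cdot 49^{\alpha+1} p^{2 \beta} n+\frac{(5+12 s) \cdot 7^{2 \alpha+1} p^{2 \beta}-5}{6}\right) \equiv 0\pmod 2,$$ where $r\in\{3,4,6\}$ and $s\in\{2,4,5\}$. (2) For all integers $n,\alpha,\beta\ge0$ with $p\nmid n$, $$p_{7,7}\left(2 \cdot 49^{\alpha} p^{2 \beta+1} n+\frac{11 \cdot 49^{\alpha} p^{2 \beta+2}-5}{6}\right) \equiv 0\pmod 2.$$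
   Context: For a partition $\lambda$, $\mathrm{mex}_{7,7}(\lambda)$ is the smallest positive multiple of $7$ that is not a part of $\lambda$; $p_{7,7}(n)$ is the number of partitions $\lambda$ of $n$ with $\mathrm{mex}_{7,7}(\lambda)\equiv 7 \pmod{14}$. *)

(* Defs.v *)
From mathcomp Require Import all_boot all_order all_algebra.
From mathcomp Require Import zify.

Set Implicit Arguments.
Unset Strict Implicit.
Unset Printing Implicit Defensive.

Definition is_partition (n : nat) (l : seq nat) : bool :=
  [&& sorted geq l, 0 \notin l & sumn l == n].

Definition mex77_cand (l : seq nat) : pred nat :=
  fun m => [&& 0 < m, 7 %| m & m \notin l].

Lemma mex77_cand_ex (l : seq nat) : exists m, mex77_cand l m.
Proof.
exists (7 * (sumn l).+1); rewrite /mex77_cand dvdn_mulr // andTb.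
apply/negP => lm.
suff : 7 * (sumn l).+1 <= sumn l by lia.
elim: l (7 * _) lm => //= x l IH m; rewrite inE => /orP[/eqP->|/IH].
  exact: leq_addr.
by move=> h; apply: leq_trans h (leq_addl _ _).
Qed.

Definition mex77 (l : seq nat) : nat := ex_minn (mex77_cand_ex l).

(* A partition of n has at most n parts, each at most n, so the bounded
   sequences n.-bseq 'I_n.+1 contain each partition of n exactly once; see
   p77_size. *)
Definition p77 (n : nat) : nat :=
  #|[set t : n.-bseq 'I_n.+1 |
       is_partition n (map val t) && (mex77 (map val t) == 7 %[mod 14])]|.

Lemma part_leq_sumn (l : seq nat) (x : nat) : x \in l -> x <= sumn l.
Proof.
elim: l => //= y l IH; rewrite inE => /orP[/eqP->|/IH h].
  exact: leq_addr.
exact: leq_trans h (leq_addl _ _).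
Qed.

Lemma size_leq_sumn (l : seq nat) : 0 \notin l -> size l <= sumn l.
Proof.
elim: l => //= y l IH; rewrite inE negb_or => /andP[y0 /IH h].
by rewrite -add1n leq_add // lt0n eq_sym.
Qed.

Lemma p77_size (n : nat) (s : seq (seq nat)) :
    uniq s ->
    (forall l, (l \in s) = is_partition n l && (mex77 l == 7 %[mod 14])) ->
  p77 n = size s.
Proof.
move=> us sP; rewrite /p77 cardE.
set e := enum _.
pose f (t : n.-bseq 'I_n.+1) : seq nat := map val t.
rewrite -(size_map f e).
have finj : injective f.
  by move=> t1 t2 /(inj_map val_inj) /val_inj.
apply/eqP; rewrite eqn_leq !uniq_leq_size ?map_inj_uniq ?enum_uniq //.
  move=> l ls; move: (ls); rewrite sP => /andP[lp _].
  case/and3P: lp => _ l0 /eqP ln.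
  have sz : size (map (@inord n) l) <= n.
    by rewrite size_map -[X in _ <= X]ln size_leq_sumn.
  apply/mapP; exists (Bseq sz).
    rewrite mem_enum inE -sP.
    suff -> : map val (Bseq sz) = l by [].
    rewrite /= -map_comp -[RHS]map_id; apply/eq_in_map => x xl /=.
    by rewrite inordK // ltnS -ln part_leq_sumn.
  rewrite /f /= -map_comp -[LHS]map_id; apply/eq_in_map => x xl /=.
  by rewrite inordK // ltnS -ln part_leq_sumn.
move=> l /mapP[t]; rewrite mem_enum inE => tP ->.
by rewrite sP.
Qed.

(* Meaningful for p an odd prime; 'F_p is Z/pZ only when p is prime. *)
Definition legendre (a : int) (p : nat) : int :=
  if (a%:~R == 0 :> 'F_p)%R then 0%R
  else if [exists x : 'F_p, (x ^+ 2 == a%:~R)%R] then 1%R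
  else (-1)%R.

(* The divisions by 6 in the statement are exact, and the subtractions there
   are not truncated. *)
Lemma sqr_mod6 (a p b : nat) :
  prime p -> 5 <= p -> 49 ^ a * p ^ (2 * b) = 1 %[mod 6].
Proof.
move=> pp p5.
have h2 : p ^ 2 = 1 %[mod 6].
  have n2 : ~~ (2 %| p) by rewrite dvdn_prime2 //; lia.
  have n3 : ~~ (3 %| p) by rewrite dvdn_prime2 //; lia.
  rewrite -modnXm.
  have : p %% 6 \in [:: 1; 5] by rewrite !inE; lia.
  by rewrite !inE => /orP[] /eqP->.
by rewrite -modnMm -modnXm exp1n expnM -(modnXm b) h2 modnXm exp1n.
Qed.

Lemma sub5_div6 (c a p b : nat) :
    prime p -> 5 <= p -> c = 5 %[mod 6] ->
  6 * ((c * (49 ^ a * p ^ (2 * b)) - 5) %/ 6) + 5 =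
    c * (49 ^ a * p ^ (2 * b)).
Proof.
move=> pp p5 c5; set S := _ * p ^ _.
have S1 : S = 1 %[mod 6] by exact: sqr_mod6.
have : c * S = 5 %[mod 6] by rewrite -modnMm c5 S1.
lia.
Qed.

(* Main.v *)
Require Import Defs.
From mathcomp Require Import all_boot all_order all_algebra.
From mathcomp Require Import zify ring.

Set Implicit Arguments.
Unset Strict Implicit.
Unset Printing Implicit Defensive.

Import GRing.Theory.

(* Write f_k = \prod_i (1 - q^(ki)) and psi(q) = \sum_s q^(s(s+1)/2). Counting the
   k for which 7, 14, ..., 7k are all parts gives
   \sum p77(n) q^n = psi(q^7) / f_1 mod 2. By Gauss' identity psi = f_1^3 mod 2,
   so multiplying by f_1^4 = f_4 turns the right-hand side into psi(q) psi(q^7).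
   Multiplication by (1 + sqrt(-7))/2 shows that the coefficient of q^(2n+1) in
   psi(q) psi(q^7) is that of q^n; hence \sum p77(2n+1) q^n = f_1 psi(q^7) mod 2.
   By Euler's pentagonal number theorem p77(2n+1) is therefore even unless
   x^2 + 21 y^2 = 24n + 22 is solvable. For the indices of the theorem it is not:
   since -21 is not a square mod p, p | x^2 + 21 y^2 forces p | x and p | y, so
   even powers of p (and of 7) cancel, and what remains is excluded by an odd
   power of p or by the quadratic residues mod 7. *)

(** * Polynomial identities behind the theorems of Euler and Gauss *)

Section FiniteThetaIdentities.
Local Open Scope ring_scope.
Variables (R : comNzRingType) (q : R).

(* Shanks' finite form of the pentagonal number theorem: the term of index s
   telescopes against g under n -> n + 1. *)
Lemma euler_partial n :
  \sum_(0 <= s < n.+1) (-1) ^+ s * (\prod_(s <= i < n) (1 - q ^+ i.+1)) *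
      q ^+ (s * n + 'C(s.+1, 2))
  = 1 + \sum_(0 <= k < n) (-1) ^+ k.+1 *
      (q ^+ (k.+1 ^ 2 + 'C(k.+1, 2)) + q ^+ (k.+1 ^ 2 + 'C(k.+2, 2))).
Proof.
elim: n => [|n IH]; first by rewrite big_nat1 !big_geq // !mulr1 addr0.
rewrite [in RHS]big_nat_recr //= [in RHS]addrA -IH {IH}.
pose h s := (-1) ^+ s * (\prod_(s <= i < n) (1 - q ^+ i.+1)) *
  q ^+ (s * n + 'C(s.+1, 2)).
(* The product from [s.-1] contains the extra factor [1 - q ^+ s]. At s = 0 that factor is 0, a
   value supplied by [*+ (0 < s)] since [s.-1] is truncated. *)
pose g s := (-1) ^+ s * (\prod_(s.-1 <= i < n) (1 - q ^+ i.+1)) *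
  q ^+ (s * n + 'C(s.+1, 2)) *+ (0 < s)%N.
have step s : (s < n.+1)%N ->
    (-1) ^+ s * (\prod_(s <= i < n.+1) (1 - q ^+ i.+1)) *
      q ^+ (s * n.+1 + 'C(s.+1, 2)) = h s + (g s.+1 - g s).
  move=> sn; rewrite /g /h /= mulr1n big_nat_recr //=.
  have -> : (s * n.+1 + 'C(s.+1, 2) = (s * n + 'C(s.+1, 2)) + s)%N by lia.
  have -> : (s.+1 * n + 'C(s.+2, 2) = (s * n + 'C(s.+1, 2)) + (n + s.+1))%N.
    by rewrite [in LHS]binS bin1; lia.
  set P := \prod_(s <= i < n) _.
  have -> : (-1) ^+ s * (\prod_(s.-1 <= i < n) (1 - q ^+ i.+1)) *
      q ^+ (s * n + 'C(s.+1, 2)) *+ (0 < s)%N =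
      (-1) ^+ s * P * q ^+ (s * n + 'C(s.+1, 2)) * (1 - q ^+ s).
    case: s sn @P => [|s] sn P /=; first by rewrite expr0 subrr mulr0.
    by rewrite mulr1n big_ltn // -/P; ring.
  by rewrite !exprD !exprS; ring.
rewrite big_nat_recr //= (eq_big_nat _ _ (F2 := fun s => h s + (g s.+1 - g s))); last first.
  by move=> s /andP[_ sn]; exact: step.
rewrite big_split /= telescope_sumr // [g 0%N]mulr0n subr0 -addrA; congr (_ + _).
rewrite /g /= !big_geq // mulr1n !mulr1 -mulrDr; congr (_ * (_ + _)).
  by congr (q ^+ _); rewrite binS bin1; lia.
Qed.

(* Shanks' finite form of Gauss' identity
   \sum q^(s(s+1)/2) = \prod (1 - q^(2i)) / (1 - q^(2i-1)), with the
   denominators cleared. *)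
Lemma gauss_partial n :
  \sum_(0 <= s < n) (\prod_(0 <= i < s) (1 - q ^+ i.*2.+1)) *
      (\prod_(s <= i < n) (1 - q ^+ i.+1.*2)) * q ^+ (s * n.*2.+1)
  = (\prod_(0 <= i < n) (1 - q ^+ i.*2.+1)) *
      \sum_(0 <= s < n.*2) q ^+ 'C(s.+1, 2).
Proof.
elim: n => [|n IH]; first by rewrite !big_geq // mulr0.
rewrite doubleS (big_nat_recr n.*2.+1) //= (big_nat_recr n.*2) //=.
rewrite [X in _ = X * _]big_nat_recr //= -addrA mulrDr.
set D := fun s => \prod_(0 <= i < s) (1 - q ^+ i.*2.+1) in IH *.
pose u s := D s * (\prod_(s <= i < n) (1 - q ^+ i.+1.*2)) * q ^+ (s * n.*2.+1).
rewrite -/(D n) mulrAC -IH -/(u _).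
pose g s := u s * (1 - q ^+ s.*2).
have step s : (s < n)%N ->
   D s * (\prod_(s <= i < n.+1) (1 - q ^+ i.+1.*2)) * q ^+ (s * n.+1.*2.+1) =
   u s * (1 - q ^+ n.*2.+1) + (g s.+1 - g s).
  move=> sn; rewrite /g /u big_nat_recr //=; last by lia.
  have -> : (s * n.+1.*2.+1 = s * n.*2.+1 + s.*2)%N by lia.
  have -> : D s.+1 = D s * (1 - q ^+ s.*2.+1) by rewrite /D big_nat_recr.
  rewrite !(big_ltn sn).
  rewrite mulSn doubleS !exprD !exprS.
  by ring.
rewrite big_nat_recr //=.
rewrite (eq_big_nat _ _ (F2 := fun s => u s * (1 - q ^+ n.*2.+1) + (g s.+1 - g s))); last first.
  by move=> s /andP[_ sn]; exact: step.
rewrite big_split /= telescope_sumr // -mulr_suml -!addrA; congr (_ + _).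
have -> : g 0%N = 0 by rewrite /g double0 expr0 subrr mulr0.
rewrite /g /u oppr0 add0r big_geq // mulr1 big_nat1.
have -> : ('C(n.*2.+1, 2) = n * n.*2.+1)%N by rewrite bin2odd /= ?odd_double ?uphalf_double ?doubleK; lia.
have -> : ('C(n.*2.+2, 2) = n * n.*2.+1 + n.*2.+1)%N.
  rewrite binS bin1; congr (_ + _)%N.
  by rewrite bin2odd /= ?odd_double ?doubleK; lia.
have -> : (n * n.+1.*2.+1 = n * n.*2.+1 + n.*2)%N by lia.
by rewrite -/(D n) doubleS !exprD !exprS; ring.
Qed.

End FiniteThetaIdentities.

(** * Partitions with prescribed parts, and the parity of [p77] *)

Definition partitions (n : nat) : seq (seq nat) :=
  [seq l <- [seq map val (bseqval t) | t <- enum {: n.-bseq 'I_n.+1}]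
  | is_partition n l].

Lemma partitions_uniq n : uniq (partitions n).
Proof.
rewrite filter_uniq // map_inj_uniq ?enum_uniq //.
by move=> t1 t2 /(inj_map val_inj) /val_inj.
Qed.

Lemma mem_partitions n l : (l \in partitions n) = is_partition n l.
Proof.
rewrite mem_filter andb_idr // => /and3P[_ l0 /eqP ln].
have sz : size (map (@inord n) l) <= n.
  by rewrite size_map -[X in _ <= X]ln size_leq_sumn.
apply/mapP; exists (Bseq sz); first by rewrite mem_enum.
rewrite /= -map_comp -[LHS]map_id; apply/eq_in_map => x xl /=.
by rewrite inordK // ltnS -ln part_leq_sumn.
Qed.

Lemma is_partition_ins x n l : 0 < x ->
  is_partition n l -> is_partition (x + n) (sort geq (x :: l)).
Proof.
move=> x0 /and3P[_ l0 /eqP ln]; rewrite /is_partition sort_sorted; last first.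
  by move=> a b; rewrite /geq /= leq_total.
rewrite mem_sort inE negb_or eq_sym -lt0n x0 l0 /=.
by rewrite (perm_sumn (permEl (perm_sort _ _))) /= ln.
Qed.

Lemma is_partition_rem x n l : x \in l ->
  is_partition n l -> is_partition (n - x) (rem x l).
Proof.
move=> xl /and3P[sl l0 /eqP ln]; apply/and3P; split.
- by apply: subseq_sorted (rem_subseq x l) sl => a b c /= h1 h2; apply: leq_trans h2 h1.
- by apply: contra l0; apply: mem_rem.
- by rewrite -ln (perm_sumn (perm_to_rem xl)) /= addKn.
Qed.

Lemma sort_cons_rem x n l : x \in l -> is_partition n l ->
  sort geq (x :: rem x l) = l.
Proof.
move=> xl /and3P[sl _ _].
have tot : total geq by move=> a b; rewrite /geq /= leq_total.
have tr : transitive geq by move=> a b c /= h1 h2; apply: leq_trans h2 h1.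
apply: (sorted_eq tr) => //.
- by move=> a b /=; rewrite /geq /= andbC => h; apply/eqP; rewrite eqn_leq.
- exact: sort_sorted.
- by rewrite perm_sort perm_sym perm_to_rem.
Qed.

(* Deleting one copy of x is a bijection from the partitions of n that contain
   x onto the partitions of n - x. *)
Lemma count_partitions_mem x n (Q Q' : pred (seq nat)) : 0 < x ->
    (forall l l', perm_eq l' (x :: l) -> Q l' = Q' l) ->
  count (fun l => (x \in l) && Q l) (partitions n) =
  if x <= n then count Q' (partitions (n - x)) else 0.
Proof.
move=> x0 QQ'; case: leqP => [xn|nx]; last first.
  apply/eqP; rewrite eqn0Ngt -has_count; apply/hasPn => l.
  rewrite mem_partitions => /and3P[_ _ /eqP ln].
  by apply: contraL nx => /andP[/part_leq_sumn]; rewrite ln leqNgt.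
rewrite -!size_filter.
set A := filter _ _; set B := filter _ _.
have -> : size B = size [seq sort geq (x :: l) | l <- B] by rewrite size_map.
apply/perm_size/uniq_perm.
- by rewrite filter_uniq // partitions_uniq.
- rewrite map_inj_in_uniq => [|l1 l2]; first by rewrite /B filter_uniq // partitions_uniq.
  rewrite (mem_filter _ l1) (mem_filter _ l2) !mem_partitions => /andP[_ /and3P[s1 _ _]] /andP[_ /and3P[s2 _ _]] e.
  apply: (sorted_eq (leT := geq)) => //.
  + by move=> a b c /= h1 h2; apply: leq_trans h2 h1.
  + by move=> a b /=; rewrite /geq /= andbC => h; apply/eqP; rewrite eqn_leq.
  + by rewrite -(perm_cons x) -(perm_sort geq) e perm_sort.
move=> l; apply/idP/mapP.
  rewrite mem_filter mem_partitions => /andP[/andP[xl Ql] pl].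
  exists (rem x l); last by rewrite (sort_cons_rem xl pl).
  rewrite mem_filter mem_partitions is_partition_rem // andbT.
  by rewrite -(QQ' _ l) ?perm_to_rem.
case=> l'; rewrite mem_filter mem_partitions => /andP[Ql' pl'] ->.
rewrite mem_filter mem_partitions mem_sort mem_head /=.
rewrite (QQ' l') ?Ql'; last by rewrite perm_sort.
by have := is_partition_ins x0 pl'; rewrite subnKC.
Qed.

Definition npart n := size (partitions n).

(** The entries of [ds] are distinct, so deleting a copy of one does not affect the presence of the
    others, and they can be deleted one after another. *)
Lemma count_subset_partitions ds n : uniq ds -> 0 \notin ds ->
  count (fun l => all (fun x => x \in l) ds) (partitions n) =
  if sumn ds <= n then npart (n - sumn ds) else 0.
Proof.
elim: ds n => [|x ds IH] n /=.
  by move=> _ _; rewrite subn0 count_predT.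
rewrite inE negb_or eq_sym -lt0n => /andP[xds uds] /andP[x0 ds0].
rewrite (@count_partitions_mem x n _ (fun l => all (fun y => y \in l) ds)) //.
  case: leqP => [xn|nx]; last by rewrite leqNgt ltn_addr.
  by rewrite IH // leq_subRL // subnDA.
move=> l l' e; apply/eq_in_all => y yds.
rewrite (perm_mem e) inE; case: eqP => // yx.
by rewrite -yx yds in xds.
Qed.

Lemma sumn_multiples k : sumn [seq 7 * i | i <- iota 1 k] = 7 * 'C(k.+1, 2).
Proof.
rewrite sumnE big_map -big_distrr /=; congr (_ * _).
by rewrite -bin2_sum [RHS]big_ltn // /index_iota subSS subn0.
Qed.

(* mex77 l / 7 is the number of k >= 0 such that 7, 14, ..., 7k are all parts. *)
Lemma mex77_odd n l : is_partition n l ->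
  (mex77 l == 7 %[mod 14]) =
  odd (\sum_(k < n.+1) all (fun x => x \in l) [seq 7 * i | i <- iota 1 k]).
Proof.
move=> /and3P[_ l0 /eqP ln]; rewrite /mex77; case: ex_minnP => m.
case/and3P=> m0 /dvdnP[j mj] ml mmin.
(* Otherwise 7(n+1) would lie below the mex and so be a part, although it exceeds n. Hence the range
   of k is long enough. *)
have jn : j <= n.+1.
  case: (leqP j n.+1) => // jn.
  suff : 7 * n.+1 <= n by lia.
  rewrite -[X in _ <= X]ln; apply: part_leq_sumn.
  apply/negPn/negP => h.
  have : m <= 7 * n.+1 by apply: mmin; rewrite /mex77_cand h dvdn_mulr.
  lia.
have -> : \sum_(k < n.+1) all (fun x => x \in l) [seq 7 * i | i <- iota 1 k] = j.
  (* By minimality of m = 7j, the multiples 7, ..., 7k are all parts exactly when k < j. *)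
  transitivity (\sum_(k < n.+1) (k < j)).
    apply: eq_bigr => k _; congr nat_of_bool; apply/allP/idP => [h|kj x].
      rewrite ltnNge; apply: contra ml => jk; rewrite mj mulnC.
      by apply: h; apply: map_f; rewrite mem_iota; lia.
    case/mapP=> i; rewrite mem_iota => ik ->.
    apply/negPn/negP => h.
    have : m <= 7 * i by apply: mmin; rewrite /mex77_cand h dvdn_mulr //; lia.
    lia.
  rewrite -(big_mkord xpredT (fun k => nat_of_bool (k < j))) /=.
  rewrite (big_cat_nat (leq0n j) jn) /= [X in X + _](eq_big_nat _ _ (F2 := fun _ => 1)); last first.
    by move=> k /andP[_ ->].
  rewrite sum_nat_const_nat [X in _ + X]big_nat_cond big1; first by lia.
  by move=> k; case: ltnP => //; lia.
rewrite mj; lia.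
Qed.

(** By [mex77_odd] each partition may be weighted by its number of admissible k. Exchanging the sums
    leaves, for each k, the partitions that contain 7, ..., 7k. *)
Lemma p77_parity n :
  odd (p77 n) = odd (\sum_(k < n.+1) (if 7 * 'C(k.+1, 2) <= n
                                     then npart (n - 7 * 'C(k.+1, 2)) else 0)).
Proof.
rewrite (@p77_size n [seq l <- partitions n | mex77 l == 7 %[mod 14]]); first last.
- by move=> l; rewrite mem_filter mem_partitions andbC.
- by rewrite filter_uniq // partitions_uniq.
have cnt k : (if 7 * 'C(k.+1, 2) <= n then npart (n - 7 * 'C(k.+1, 2)) else 0) =
    \sum_(l <- partitions n) all (fun x => x \in l) [seq 7 * i | i <- iota 1 k].
  rewrite -sumn_multiples -count_subset_partitions.
  - by rewrite -sum1_count big_mkcond.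
  - by rewrite map_inj_uniq ?iota_uniq // => a b; lia.
  - by apply/mapP => -[i]; rewrite mem_iota; lia.
under [in RHS]eq_bigr => k _ do rewrite cnt.
rewrite size_filter exchange_big /= -sum1_count big_mkcond /=.
have: {subset partitions n <= is_partition n} by move=> l; rewrite mem_partitions.
elim: (partitions n) => [|l s IH] sub; first by rewrite !big_nil.
rewrite !big_cons !oddD IH; last by move=> l' ls; apply: sub; rewrite inE ls orbT.
congr (_ (+) _); rewrite (mex77_odd (sub l (mem_head _ _))).
by case: ifP.
Qed.

(** Either m+1 is absent and the bound drops to m, or one copy of m+1 is deleted. *)
Lemma npart_bounded m n :
  count (all (leq^~ m.+1)) (partitions n) =
  count (all (leq^~ m)) (partitions n) +
  (if m.+1 <= n then count (all (leq^~ m.+1)) (partitions (n - m.+1)) else 0).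
Proof.
rewrite -(@count_partitions_mem m.+1 n (all (leq^~ m.+1))) //; last first.
  by move=> l l' e; rewrite (perm_all _ e) /= leqnn.
have -> : count (all (leq^~ m)) (partitions n) =
    count (fun l => (m.+1 \notin l) && all (leq^~ m.+1) l) (partitions n).
  apply: eq_count => l /=.
  elim: l => //= x l ->; rewrite inE.
  case: (m.+1 \in l); rewrite ?orbT ?andbF //= orbF.
  by case: (all _ _); rewrite ?andbF // !andbT; lia.
elim: (partitions n) => //= l s ->.
by case: (_ \in l); rewrite /= add0n; [exact: addnCA | exact: addnA].
Qed.

(** * Halving in the quadratic form U^2 + 7V^2, over the natural numbers *)

Definition adist (x y : nat) := (x - y) + (y - x).

(* With U = 2a+1 and V = 2b+1, tri7 (a, b) = m reads U^2 + 7V^2 = 8(m + 1).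
   tri7_half divides U + V sqrt(-7), with the sign of V chosen so that the result
   is again odd, by (1 + sqrt(-7))/2, an element of norm 2; tri7_double is its
   inverse. *)
Definition tri7_half (ab : nat * nat) : nat * nat :=
  let: (a, b) := ab in
  if odd a == odd b then ((a + 7 * b + 2) %/ 4, (adist a b - 2) %/ 4)
  else ((adist a (7 * b + 3) - 2) %/ 4, (a + b - 1) %/ 4).

Definition tri7_double (cd : nat * nat) : nat * nat :=
  let: (c, d) := cd in
  if odd c == odd d then ((adist c (7 * d + 3) - 1) %/ 2, (c + d) %/ 2)
  else ((c + 7 * d + 3) %/ 2, (adist c d - 1) %/ 2).

Definition tri7 (ab : nat * nat) := 'C(ab.1.+1, 2) + 7 * 'C(ab.2.+1, 2).

Lemma mul2_tri a : 2 * 'C(a.+1, 2) = a * a.+1.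
Proof.
by elim: a => [|a IH]; [rewrite bin_small | rewrite binS bin1 mulnDr IH; lia].
Qed.

Lemma tri7_halfP n ab : tri7 ab = 2 * n + 1 ->
  tri7 (tri7_half ab) = n /\ tri7_double (tri7_half ab) = ab.
Proof.
case: ab => a b; case F: (tri7_half (a, b)) => [c d]; rewrite /tri7 /= => e.
have {e} E : a * a.+1 + 7 * (b * b.+1) = 4 * n + 2.
  by have := mul2_tri a; have := mul2_tri b; lia.
suff [h1 h2] : c * c.+1 + 7 * (d * d.+1) = 2 * n /\ tri7_double (c, d) = (a, b).
  by split; [have := mul2_tri c; have := mul2_tri d; lia | exact: h2].
have {F} [] : (4 * d + 2 = adist a b /\ 4 * c = a + 7 * b + 2) \/
    (4 * d + 1 = a + b /\ 4 * c + 2 = adist a (7 * b + 3)).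
  move: F; rewrite /tri7_half /adist.
  have [a' ea] : exists a', a = 4 * a' + a %% 4 by exists (a %/ 4); lia.
  have [b' eb] : exists b', b = 4 * b' + b %% 4 by exists (b %/ 4); lia.
  have ra : a %% 4 \in [:: 0; 1; 2; 3] by rewrite !inE; lia.
  have rb : b %% 4 \in [:: 0; 1; 2; 3] by rewrite !inE; lia.
  (* Modulo 4, [E] reads (a - b)(a + b + 1) = 2. The factors have opposite parity, so one of them is
     2 modulo 4; these are the two branches of [tri7_half]. *)
  have : a %% 4 = (b + 2) %% 4 \/ (a + b) %% 4 = 1.
    move: ra rb; rewrite !inE => /or4P[]/eqP ra /or4P[]/eqP rb;
    rewrite ra in ea; rewrite rb in eb; subst a b; lia.
  case=> h; case: eqP => ho [<- <-]; [left|exfalso|exfalso|right]; lia.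
- rewrite /tri7_double /adist => -[h1 h2]; split.
    (* Once the sign of a - b is fixed, two of the variables are linear in the other two, and after
       substitution the goal follows linearly from [E]. *)
    have [ba|/ltnW ab] := leqP b a.
      have ea : a = b + 4 * d + 2 by lia.
      have ec : c = 2 * b + d + 1 by lia.
      subst a c; lia.
    have eb : b = a + 4 * d + 2 by lia.
    have ec : c = 2 * a + 7 * d + 4 by lia.
    subst b c; lia.
  by case: eqP => ho; congr pair; lia.
- rewrite /tri7_double /adist => -[h1 h2]; split.
    have [ba|/ltnW ab] := leqP (7 * b + 3) a.
      have ea : a = 7 * b + 5 + 4 * c by lia.
      have ed : d = 2 * b + 1 + c by lia.
      subst a d; lia.
    have ea : a + 4 * c = 7 * b + 1 by lia.
    have ed : c + d = 2 * b by lia.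
    clear h1 h2 ab; nia.
  by case: eqP => ho; congr pair; lia.
Qed.

Lemma tri7_doubleP n cd : tri7 cd = n ->
  tri7 (tri7_double cd) = 2 * n + 1 /\ tri7_half (tri7_double cd) = cd.
Proof.
case: cd => c d; case F: (tri7_double (c, d)) => [a b]; rewrite /tri7 /= => e.
have {e} E : c * c.+1 + 7 * (d * d.+1) = 2 * n.
  by have := mul2_tri c; have := mul2_tri d; lia.
suff [h1 h2] : a * a.+1 + 7 * (b * b.+1) = 4 * n + 2 /\ tri7_half (a, b) = (c, d).
  by split; [have := mul2_tri a; have := mul2_tri b; lia | exact: h2].
have {F} [] : (2 * b = c + d /\ 2 * a + 1 = adist c (7 * d + 3)) \/
    (2 * b + 1 = adist c d /\ 2 * a = c + 7 * d + 3).
  move: F; rewrite /tri7_double /adist.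
  case: eqP => ho [<- <-]; [left|right]; lia.
- rewrite /tri7_half /adist => -[h1 h2]; split.
    have [ba|/ltnW ab] := leqP (7 * d + 3) c.
      have ec : c = 7 * d + 4 + 2 * a by lia.
      have eb : b = 4 * d + 2 + a by lia.
      subst c b; lia.
    have ec : c + 2 * a = 7 * d + 2 by lia.
    clear h2 ab; nia.
  by case: eqP => ho; congr pair; lia.
- rewrite /tri7_half /adist => -[h1 h2]; split.
    have [ba|/ltnW ab] := leqP d c.
      have ec : c = 2 * b + 1 + d by lia.
      have ea : a = b + 4 * d + 2 by lia.
      subst c a; lia.
    have ed : d = 2 * b + 1 + c by lia.
    have ea : a = 4 * c + 7 * b + 5 by lia.
    subst d a; lia.
  by case: eqP => ho; congr pair; lia.
Qed.

Definition npairs (K : nat) := [seq (a, b) | a <- index_iota 0 K, b <- index_iota 0 K].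

Lemma mem_npairs K ab : (ab \in npairs K) = (ab.1 < K) && (ab.2 < K).
Proof.
case: ab => a b; apply/allpairsP/andP => /= [[[x y] /= []]|[aK bK]].
  by rewrite !mem_index_iota => /andP[_ xK] /andP[_ yK] [-> ->].
by exists (a, b); rewrite !mem_index_iota.
Qed.

Lemma npairs_uniq K : uniq (npairs K).
Proof. by apply: allpairs_uniq; rewrite ?iota_uniq // => -[a b] [c d]. Qed.

Lemma leq_tri a : a <= 'C(a.+1, 2).
Proof. by have := mul2_tri a; nia. Qed.

Lemma tri7_npairs K ab : tri7 ab < K -> ab \in npairs K.
Proof.
case: ab => a b; rewrite mem_npairs /tri7 /=.
by move: (leq_tri a) (leq_tri b) => ha hb h; apply/andP; split; lia.
Qed.

(** [tri7] dominates both coordinates, so the box holds every solution of both equations, and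
    [tri7_half] matches them bijectively. *)
Lemma count_tri7_odd K n : 2 * n + 1 < K ->
  count (fun ab => tri7 ab == 2 * n + 1) (npairs K) =
  count (fun cd => tri7 cd == n) (npairs K).
Proof.
move=> nK; rewrite -!size_filter.
set A := filter _ _; set B := filter _ _.
rewrite -(size_map tri7_half A).
have memA x : x \in A -> tri7 x = 2 * n + 1 by rewrite mem_filter => /andP[/eqP].
apply/perm_size/uniq_perm; last 1 first.
- move=> cd; apply/mapP/idP => [[ab abA ->]|].
    have [h _] := tri7_halfP (memA _ abA).
    by rewrite mem_filter h eqxx tri7_npairs // h; lia.
  rewrite mem_filter => /andP[/eqP h _]; have [h1 h2] := tri7_doubleP h.
  by exists (tri7_double cd); rewrite // mem_filter h1 eqxx tri7_npairs // h1.
- rewrite map_inj_in_uniq ?filter_uniq ?npairs_uniq // => x y /memA /tri7_halfP[_ hx].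
  by move=> /memA /tri7_halfP[_ hy] e; rewrite -hx -hy e.
- by rewrite filter_uniq ?npairs_uniq.
Qed.

(** * Congruence modulo X^N, in place of formal power series *)

Section Congruence.
Local Open Scope ring_scope.
Variable R : comNzRingType.
Implicit Types p q r : {poly R}.

Definition eqX (N : nat) p q := forall i, (i < N)%N -> p`_i = q`_i.

Lemma eqX_sym N p q : eqX N p q -> eqX N q p.
Proof. by move=> h i iN; rewrite h. Qed.

Lemma eqX_trans N p q r : eqX N p q -> eqX N q r -> eqX N p r.
Proof. by move=> h1 h2 i iN; rewrite h1 ?h2. Qed.

Lemma eqX_leq M N p q : (M <= N)%N -> eqX N p q -> eqX M p q.
Proof. by move=> MN h i iM; rewrite h // (leq_trans iM). Qed.

Lemma eqX_mul N p p' q q' : eqX N p p' -> eqX N q q' -> eqX N (p * q) (p' * q').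
Proof.
move=> hp hq i iN; rewrite !coefM; apply: eq_bigr => j _.
by rewrite hp ?hq //; have := ltn_ord j; lia.
Qed.

Lemma eqX_addM N p r k : (N <= k)%N -> eqX N (p + r * 'X^k) p.
Proof.
by move=> Nk i iN; rewrite coefD coefMXn (leq_trans iN Nk) addr0.
Qed.

Lemma eqX_addXsum N p m k (F : nat -> {poly R}) (d : nat -> nat) :
    (forall s, (m <= s < k)%N -> (N <= d s)%N) ->
  eqX N (p + \sum_(m <= s < k) F s * 'X^(d s)) p.
Proof.
move=> h i iN; rewrite coefD coef_sum big_nat big1 ?addr0 // => s sk.
by rewrite coefMXn (leq_trans iN (h s sk)).
Qed.

(** Multiply by [p], the inverse of [f] modulo X^N. *)
Lemma eqX_cancel N f p q r : eqX N (p * f) 1 -> eqX N (f * q) (f * r) -> eqX N q r.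
Proof.
move=> pf fqr; apply: (@eqX_trans _ _ (p * f * q)).
  by apply: eqX_sym; rewrite -{2}[q]mul1r; apply: eqX_mul.
apply: (@eqX_trans _ _ (p * f * r)); first by rewrite -!mulrA; apply: eqX_mul.
by rewrite -{2}[r]mul1r; apply: eqX_mul.
Qed.

Lemma eqX_odd_poly N M p q : (M.*2 <= N)%N -> eqX N p q ->
  eqX M (odd_poly p) (odd_poly q).
Proof. by move=> MN h i iM; rewrite !coef_odd_poly h //; lia. Qed.

(** [h \Po 'X^2] has only even exponents, so it factors out of the odd part, where halving the
    exponents turns it back into [h]. *)
Lemma odd_poly_mulX2 p h : odd_poly (p * (h \Po 'X^2)) = odd_poly p * h.
Proof.
have odd_compX2 q : odd_poly (q \Po 'X^2) = 0.
  apply/polyP => i; rewrite coef_odd_poly coef_comp_poly_Xn // coef0.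
  by case: ifP => //; lia.
have even_compX2 q : even_poly (q \Po 'X^2) = q.
  apply/polyP => i; rewrite coef_even_poly coef_comp_poly_Xn //.
  by rewrite -muln2 dvdn_mull // mulnK.
rewrite -{1}(poly_even_odd p) mulrDl odd_polyD -comp_polyM odd_compX2 add0r.
by rewrite mulrAC -comp_polyM odd_polyMX even_compX2.
Qed.

(** * Truncated generating functions and product identities *)

Definition euler_prod (n : nat) : {poly R} := \prod_(0 <= i < n) (1 - 'X^(i.+1)).

Lemma euler_prod_stable n m : (n <= m)%N -> eqX n.+1 (euler_prod m) (euler_prod n).
Proof.
elim: m => [|m IH]; first by rewrite leqn0 => /eqP->.
rewrite leq_eqVlt => /orP[/eqP-> //|nm].
rewrite /euler_prod big_nat_recr //= mulrBr mulr1 -mulNr.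
apply: (eqX_trans _ (IH nm)).
by apply: eqX_addM; lia.
Qed.

Definition bounded_gf N m : {poly R} :=
  \poly_(i < N) (count (all (leq^~ m)) (partitions i))%:R.

(** By [npart_bounded], multiplication by 1 - X^(m+1) lowers the bound on the parts from m+1 to m;
    with bound 0 only the empty partition remains. *)
Lemma bounded_gf_mul N m : eqX N (bounded_gf N m * euler_prod m) 1.
Proof.
elim: m => [|m IH].
  rewrite /euler_prod big_geq // mulr1 => i iN; rewrite coef_poly iN coef1.
  case: i iN => [|i] iN.
    rewrite (_ : count _ _ = 1%N) // (_ : partitions 0 = [:: [::]]) //.
    apply/perm_small_eq => //; apply: uniq_perm; rewrite ?partitions_uniq //.
    move=> l; rewrite mem_partitions inE; case: l => //= x l.
    apply/negbTE; rewrite /is_partition inE negb_or /=.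
    by case: x => [|x]; rewrite ?andbF // addSn andbF.
  rewrite (_ : count _ _ = 0%N) //; apply/eqP; rewrite eqn0Ngt -has_count.
  apply/hasPn => l; rewrite mem_partitions => /and3P[_ l0 /eqP sl].
  case: l l0 sl => [|x l] //=; rewrite inE negb_or => /andP[x0 _] _.
  by rewrite leqn0 negb_and eq_sym x0.
apply: (eqX_trans _ IH); rewrite /euler_prod big_nat_recr //= [_ * (1 - _)]mulrC mulrA.
apply: eqX_mul => // i iN.
rewrite mulrBr mulr1 coefB coefMXn !coef_poly iN npart_bounded natrD.
case: (ltnP i m.+1) => im; first by rewrite subr0 addr0.
by rewrite (leq_ltn_trans (leq_subr _ _) iN) addrK.
Qed.

Definition npart_gf N : {poly R} := \poly_(i < N) (npart i)%:R.

(** Below degree n+1 the bound n+1 on the parts, like the bound n, holds automatically. *)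
Lemma npart_gf_mul n : eqX n.+1 (npart_gf n.+1 * euler_prod n) 1.
Proof.
apply: (eqX_trans _ (@bounded_gf_mul n.+1 n)); apply: eqX_mul => // i iN.
rewrite !coef_poly iN /npart -count_predT; congr (_%:R).
apply: eq_in_count => l; rewrite mem_partitions => /and3P[_ _ /eqP sl] /=.
by apply/esym/allP => x /part_leq_sumn; rewrite sl; lia.
Qed.

Definition pentagonal_gf (n : nat) : {poly R} :=
  1 + \sum_(0 <= k < n) (-1) ^+ k.+1 *
      ('X^(k.+1 ^ 2 + 'C(k.+1, 2)) + 'X^(k.+1 ^ 2 + 'C(k.+2, 2))).

(** In [euler_partial] the term s = 0 is the Euler product itself, and every term with s > 0 has
    exponent at least n+1. *)
Lemma euler_pentagonal n : eqX n.+1 (euler_prod n) (pentagonal_gf n).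
Proof.
rewrite /pentagonal_gf -euler_partial big_ltn // expr0 mul1r mul0n mulr1.
apply/eqX_sym/eqX_addXsum => s /andP[s0 _].
by have := leq_tri s; nia.
Qed.

Definition tri_gf (c n : nat) : {poly R} := \sum_(0 <= s < n) 'X^(c * 'C(s.+1, 2)).

(** Again only the term s = 0 of the finite identity survives, the others being divisible by
    X^(2n+1). *)
Lemma gauss_triangular n : (0 < n)%N ->
  eqX n.*2.+1 ((\prod_(0 <= i < n) (1 - 'X^(i.*2.+1))) * tri_gf 1 n.*2)
    (\prod_(0 <= i < n) (1 - 'X^(i.+1.*2))).
Proof.
move=> n0; have -> : tri_gf 1 n.*2 = \sum_(0 <= s < n.*2) 'X^('C(s.+1, 2)).
  by apply: eq_bigr => s _; rewrite mul1n.
rewrite -gauss_partial [X in eqX _ X _]big_ltn // (@big_geq _ _ _ 0 0) //.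
rewrite mul0n mulr1 mul1r.
by apply/eqX_addXsum => s /andP[s0 _]; nia.
Qed.

Lemma euler_prod_double n : euler_prod n.*2 =
  (\prod_(0 <= i < n) (1 - 'X^(i.*2.+1))) * \prod_(0 <= i < n) (1 - 'X^(i.+1.*2)).
Proof.
elim: n => [|n IH]; first by rewrite /euler_prod !big_geq // mulr1.
rewrite /euler_prod doubleS 2?big_nat_recr //= -/(euler_prod _) IH.
by rewrite [in RHS]big_nat_recr //= [in RHS]big_nat_recr //=; ring.
Qed.

Lemma coef_tri_gf_mul K i :
  (tri_gf 1 K * tri_gf 7 K)`_i = (count (fun ab => tri7 ab == i) (npairs K))%:R.
Proof.
rewrite /tri_gf big_distrl /= coef_sum -sum1_count natr_sum [RHS]big_mkcond /=.
rewrite /npairs big_allpairs; apply: eq_bigr => a _.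
rewrite big_distrr /= coef_sum; apply: eq_bigr => b _.
by rewrite -exprD coefXn /tri7 /= mul1n eq_sym; case: eqP.
Qed.

End Congruence.

(** * Reduction modulo 2 and the generating function of p77(2n+1) *)

Section ModTwo.
Local Open Scope ring_scope.
Implicit Types p q : {poly 'F_2}.

Local Notation f n := (euler_prod 'F_2 n).
Local Notation psi c n := (tri_gf 'F_2 c n).

Lemma natF2 (n : nat) : n%:R = (odd n)%:R :> 'F_2.
Proof.
by apply/val_inj; rewrite /= !val_Fp_nat //= modn2; case: (odd n).
Qed.

Lemma two_polyF2 : 2%:R = 0 :> {poly 'F_2}.
Proof. by rewrite -polyC_natr natF2. Qed.

Lemma sqr_1subF2 p : (1 - p) ^+ 2 = 1 - p ^+ 2.
Proof.
have -> : (1 - p) ^+ 2 = 1 - p ^+ 2 + (p ^+ 2 - p) * 2%:R by ring.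
by rewrite two_polyF2 mulr0 addr0.
Qed.

Lemma euler_prod_sqr n : f n ^+ 2 = \prod_(0 <= i < n) (1 - 'X^(i.+1.*2)).
Proof.
rewrite /euler_prod -prodrXl; apply: eq_bigr => i _.
by rewrite sqr_1subF2 -exprM muln2.
Qed.

Lemma euler_prod_compX2 n : f n \Po 'X^2 = f n ^+ 2.
Proof.
rewrite euler_prod_sqr /euler_prod rmorph_prod; apply: eq_bigr => i _.
by rewrite rmorphB rmorph1 /= comp_Xn_poly -exprM mul2n.
Qed.

(** Modulo 2 the even-exponent factors of f_(2n) form f_n^2, and by Gauss psi turns the odd-exponent
    factors into another f_n^2. Hence f_n psi = f_n^4, and f_n cancels. *)
Lemma tri_gf_cube n : (0 < n)%N -> eqX n.+1 (psi 1 n.*2) (f n ^+ 3).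
Proof.
move=> n0; apply: (eqX_cancel (@npart_gf_mul _ n)).
rewrite -exprS; apply: (@eqX_trans _ _ _ (f n.*2 * psi 1 n.*2)).
  by apply: eqX_mul => //; apply/eqX_sym/euler_prod_stable; lia.
rewrite euler_prod_double mulrAC -euler_prod_sqr (exprM _ 2 2) [X in eqX _ _ X]expr2.
apply: eqX_mul => //; rewrite euler_prod_sqr.
by apply: (@eqX_leq _ _ n.*2.+1); [lia | apply: gauss_triangular].
Qed.

Definition p77_gf N : {poly 'F_2} := \poly_(i < N) (p77 i)%:R.

Lemma p77_gfE n : (0 < n)%N ->
  eqX n.+1 (p77_gf n.+1) (npart_gf 'F_2 n.+1 * psi 7 n.*2).
Proof.
move=> n0 i iN; rewrite coef_poly iN natF2 p77_parity -natF2 natr_sum.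
rewrite /tri_gf big_distrr coef_sum /=.
(* Terms with k > i have exponent above i; the remaining ones form the sum of [p77_parity]. *)
rewrite [RHS](@big_cat_nat _ _ _ i.+1 0 n.*2) //=; last by lia.
rewrite [X in _ = _ + X]big_nat [X in _ = _ + X]big1 ?addr0.
  rewrite big_mkord; apply: eq_bigr => k _; rewrite coefMXn coef_poly ltnNge.
  by case: (leqP _ i) => //= ki; rewrite ifT //; lia.
move=> k /andP[ik _]; rewrite coefMXn ifT //.
by have := leq_tri k; lia.
Qed.

(** Taking the odd part halves the precision, hence n = 2m. Written as a polynomial in X^2, f^4
    comes out of the odd part as f^2; cancelling this against psi = f^3 leaves one Euler product. *)
Lemma p77_odd_gf m : (0 < m)%N ->
  eqX m (odd_poly (p77_gf m.*2.+1)) (pentagonal_gf 'F_2 m.*2 * psi 7 m.*2.*2).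
Proof.
move=> m0; set n := m.*2; set F := p77_gf _.
have n0 : (0 < n)%N by lia.
have psi3 := tri_gf_cube n0.
have Ff : eqX n.+1 (f n * F) (psi 7 n.*2).
  apply: (@eqX_trans _ _ _ (f n * (npart_gf 'F_2 n.+1 * psi 7 n.*2))).
    by apply: eqX_mul => //; apply: p77_gfE.
  rewrite mulrCA mulrA -[X in eqX _ _ X]mul1r; apply: eqX_mul => //.
  exact: npart_gf_mul.
have FX : eqX n.+1 (F * (f n ^+ 2 \Po 'X^2)) (psi 1 n.*2 * psi 7 n.*2).
  rewrite rmorphXn /= euler_prod_compX2 -exprM mulrC (exprSr _ 3) -mulrA.
  by apply: eqX_mul => //; apply: eqX_sym.
have {}FX : eqX m (odd_poly F * f n ^+ 2) (psi 1 n.*2 * psi 7 n.*2).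
  rewrite -odd_poly_mulX2; apply: (@eqX_trans _ _ _ (odd_poly (psi 1 n.*2 * psi 7 n.*2))).
    by apply: eqX_odd_poly FX; lia.
  move=> i im; rewrite coef_odd_poly (_ : i.*2.+1 = (2 * i + 1)%N); last by lia.
  by rewrite !coef_tri_gf_mul count_tri7_odd //; lia.
have f2inv : eqX m (npart_gf 'F_2 n.+1 ^+ 2 * f n ^+ 2) 1.
  rewrite -exprMn expr2 -[1]mulr1.
  by apply: (@eqX_leq _ _ n.+1); [lia | apply: eqX_mul; apply: npart_gf_mul].
apply: (eqX_cancel f2inv); rewrite mulrC; apply: (eqX_trans FX).
rewrite mulrA; apply: eqX_mul => //; apply: (@eqX_leq _ _ n.+1); first by lia.
apply: (eqX_trans psi3); rewrite exprSr; apply: eqX_mul => //.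
exact: euler_pentagonal.
Qed.

(** Completing squares: a pentagonal exponent e satisfies 24e + 1 = x^2 with x = 1, 6j + 5 or 6j +
    7, and a triangular number T satisfies 24 * 7T + 21 = 21(2k + 1)^2. *)
Lemma p77_odd_even n :
    (forall x y : nat, x ^ 2 + 21 * y ^ 2 <> 24 * n + 22)%N ->
  ~~ odd (p77 (2 * n + 1)).
Proof.
move=> nosol; have /(_ n (ltnSn n)) := @p77_odd_gf n.+1 isT.
rewrite coef_odd_poly coef_poly ifT; last by lia.
have -> : (n.*2.+1 = 2 * n + 1)%N by lia.
rewrite natF2 /pentagonal_gf /tri_gf mulr_sumr coef_sum big1.
  by case: (odd _).
move=> /= k _; have Tk := mul2_tri k.
rewrite mulrDl mul1r coefD coefXn mulr_suml coef_sum big1.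
  case: eqP => [e|_]; last by rewrite addr0.
  by exfalso; apply: (nosol 1%N (2 * k + 1)%N); rewrite -!mulnn; lia.
move=> /= j _; rewrite -mulrA mulrDl -!exprD -signr_odd mulr_sign.
have Tj := mul2_tri j; have Tj1 := mul2_tri j.+1.
suff c0 : ('X^(j.+1 ^ 2 + 'C(j.+1, 2) + 7 * 'C(k.+1, 2)) +
    'X^(j.+1 ^ 2 + 'C(j.+2, 2) + 7 * 'C(k.+1, 2)) : {poly 'F_2})`_n = 0.
  by case: (odd _); rewrite ?coefN c0 ?oppr0.
rewrite coefD !coefXn; case: eqP => [e|_].
  by exfalso; apply: (nosol (6 * j + 5)%N (2 * k + 1)%N); rewrite -!mulnn in e *; lia.
case: eqP => [e|_]; last by rewrite addr0.
by exfalso; apply: (nosol (6 * j + 7)%N (2 * k + 1)%N); rewrite -!mulnn in e *; lia.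
Qed.

End ModTwo.

(** * Divisibility in the form x^2 + 21y^2 *)

Lemma form21_dvd (p x y : nat) : prime p -> legendre (-21)%Z p = (-1)%Z ->
  p %| x ^ 2 + 21 * y ^ 2 -> (p %| x) && (p %| y).
Proof.
move=> pp leg.
have Fdvd (m : nat) : (p %| m) = (m%:R == 0 :> 'F_p)%R.
  by rewrite -(dvdn_pcharf (pchar_Fp pp)).
rewrite !Fdvd natrD natrM !natrX => /eqP e.
have y0 : (y%:R == 0 :> 'F_p)%R.
  (* If y were nonzero, x / y would be a square root of -21 in ['F_p]. *)
  apply/negPn/negP => y0; move: leg; rewrite /legendre; case: ifP => // _.
  case: ifP => // /negbT/negP h _; apply: h; apply/existsP; exists (x%:R / y%:R)%R.
  rewrite expr_div_n -(subr_eq0) -(mulIr_eq0 _ (mulIf (expf_neq0 2 y0))).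
  have -> : ((-21)%Z%:~R = - 21%:R :> 'F_p)%R by [].
  by rewrite mulrBl divfK ?expf_neq0 // mulNr opprK e.
move: e; rewrite (eqP y0) expr0n mulr0 addr0 => /eqP.
by rewrite expf_eq0 /= => ->; rewrite eqxx.
Qed.

Definition rep21 (N : nat) := exists x y : nat, x ^ 2 + 21 * y ^ 2 = N.

Lemma rep21_descent p k m : prime p -> legendre (-21)%Z p = (-1)%Z ->
  rep21 (p ^ (2 * k) * m) -> rep21 m.
Proof.
move=> pp leg; elim: k m => [|k IH] m; first by rewrite mul1n.
move=> [x [y e]].
have p0 := prime_gt0 pp.
have /andP[/dvdnP[x' ex] /dvdnP[y' ey]] : (p %| x) && (p %| y).
  by apply: form21_dvd => //; rewrite e mulnS expnD -mulnA dvdn_mulr // dvdn_exp.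
apply: IH; exists x', y'; apply/eqP.
rewrite -(eqn_pmul2l (n1 := _) (m := p ^ 2)) ?expn_gt0 ?p0 //; apply/eqP.
by rewrite mulnA -expnD -mulnS -e ex ey; ring.
Qed.

(** Once the even power is stripped, p divides both x and y, so p^2 divides pm. *)
Lemma rep21_odd_power p k m : prime p -> legendre (-21)%Z p = (-1)%Z ->
  ~~ (p %| m) -> ~ rep21 (p ^ (2 * k + 1) * m).
Proof.
move=> pp leg pm; rewrite expnD -mulnA => /(rep21_descent pp leg) [x [y e]].
have p0 := prime_gt0 pp.
have /andP[/dvdnP[x' ex] /dvdnP[y' ey]] : (p %| x) && (p %| y).
  by apply: form21_dvd => //; rewrite e expn1 dvdn_mulr.
case/negP: pm; apply/dvdnP; exists (x' ^ 2 + 21 * y' ^ 2).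
apply/eqP; rewrite -(eqn_pmul2l p0) -[p in p * m]expn1 -e ex ey; apply/eqP; ring.
Qed.

Lemma dvd7_sqr x a : x ^ 2 = 7 * a -> exists x', x = 7 * x'.
Proof.
move=> e; have : 7 %| x ^ 2 by rewrite e dvdn_mulr.
by rewrite Euclid_dvdX // => /andP[/dvdnP[x' ->] _]; exists x'; rewrite mulnC.
Qed.

Lemma rep21_descent49 k m : rep21 (49 ^ k * m) -> rep21 m.
Proof.
elim: k m => [|k IH] m; first by rewrite mul1n.
rewrite expnSr -mulnA => /IH[x [y e]].
have [x' ex] : exists x', x = 7 * x' by apply: (@dvd7_sqr _ (7 * m - 3 * y ^ 2)); lia.
have [y' ey] : exists y', y = 7 * y'.
  (* The witness comes from 3y^2 = 7(m - x'^2) and y^2 = 7y^2 - 2 * 3y^2. *)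
  apply: (@dvd7_sqr _ (y ^ 2 + 2 * x' ^ 2 - 2 * m)).
  by move: e; rewrite ex expnMn; lia.
by exists x', y'; move: e; rewrite ex ey !expnMn; lia.
Qed.

Lemma sqr_mod7 x : x ^ 2 %% 7 \in [:: 0; 1; 2; 4].
Proof.
rewrite -modnXm; have : x %% 7 < 7 by rewrite ltn_mod.
by case: (x %% 7) => [|[|[|[|[|[|[|]]]]]]].
Qed.

(** For N = 2n + 1 the number 2(6N + 5) is 24n + 22. *)
Lemma p77_even_rep N : N %% 2 = 1 -> ~ rep21 (2 * (6 * N + 5)) -> p77 N = 0 %[mod 2].
Proof.
move=> N1 h; have -> : N = 2 * (N %/ 2) + 1 by lia.
have /negbTE : ~~ odd (p77 (2 * (N %/ 2) + 1)).
  apply: p77_odd_even => x y e; apply: h; exists x, y; lia.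
by rewrite modn2 => ->.
Qed.

(** * The three families of indices *)

Theorem theorem3p10 (p : nat) (p_prime : prime p) (p_ge5 : 5 <= p)
    (p_legendre : legendre (-21)%Z p = (-1)%Z) :
  (forall n alpha beta : nat,
     (forall r : nat, r \in [:: 3; 4; 6] ->
        p77 (2 * 7 ^ (2 * alpha + 1) * p ^ (2 * beta) * n
             + ((11 + 12 * r) * 49 ^ alpha * p ^ (2 * beta) - 5) %/ 6)
          = 0 %[mod 2])
     /\
     (forall s : nat, s \in [:: 2; 4; 5] ->
        p77 (2 * 49 ^ (alpha + 1) * p ^ (2 * beta) * n
             + ((5 + 12 * s) * 7 ^ (2 * alpha + 1) * p ^ (2 * beta) - 5) %/ 6)
          = 0 %[mod 2]))
  /\
  (forall n alpha beta : nat,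
     ~~ (p %| n) ->
     p77 (2 * 49 ^ alpha * p ^ (2 * beta + 1) * n
          + (11 * 49 ^ alpha * p ^ (2 * beta + 2) - 5) %/ 6)
       = 0 %[mod 2]).
Proof.
have S7 a : 7 ^ (2 * a + 1) = 7 * 49 ^ a by rewrite expnD expnM mulnC.
(* Modulus 12 rather than 6 shows that the quotients by 6 are odd, so that all indices are odd as
   [p77_even_rep] requires. *)
have S12 a b : (49 ^ a * p ^ (2 * b)) %% 12 = 1.
  have := sqr_mod6 a b p_prime p_ge5.
  have odd_p : odd p by case: (even_prime p_prime) p_ge5 => [->|].
  have : (49 ^ a * p ^ (2 * b)) %% 4 = 1.
    have -> : 49 ^ a * p ^ (2 * b) = (7 ^ a * p ^ b) ^ 2.
      by rewrite expnMn -!expnM [b * 2]mulnC mulnC [RHS]mulnC [a * 2]mulnC (expnM 7 2).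
    have : odd (7 ^ a * p ^ b) by rewrite oddM !oddX odd_p !orbT.
    move: (7 ^ a * p ^ b) => t t1; rewrite -mulnn.
    have [u ->] : exists u, t = 2 * u + 1 by exists (t %/ 2); lia.
    lia.
  by move: (49 ^ a * p ^ (2 * b)) => S; lia.
split=> [n a b|n a b pn]; last first.
  have -> : 2 * 49 ^ a * p ^ (2 * b + 1) * n = 2 * (49 ^ a * (p ^ (2 * b + 1) * n)) by ring.
  rewrite (_ : 2 * b + 2 = 2 * b.+1); last by lia.
  rewrite -[11 * _ * _]mulnA.
  have := sub5_div6 a b.+1 p_prime p_ge5 (erefl (11 %% 6)).
  set q := (_ - _) %/ 6 => eq.
  have eN : 2 * (6 * (2 * (49 ^ a * (p ^ (2 * b + 1) * n)) + q) + 5) =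
      49 ^ a * (p ^ (2 * b + 1) * (2 * (12 * n + 11 * p))).
    by rewrite (mulnDr 6) -addnA eq mulnS !expnD; ring.
  apply: p77_even_rep; first by have := S12 a b.+1; lia.
  rewrite eN => /rep21_descent49; apply: rep21_odd_power => //.
  (* The cofactor 2(12n + 11p) is prime to p because p >= 5 and p does not divide n. *)
  have ndvd d : 0 < d -> d < p -> ~~ (p %| d) by move=> *; rewrite gtnNdvd.
  rewrite Euclid_dvdM // negb_or ndvd; [|lia..].
  rewrite dvdn_addl; last exact: dvdn_mull.
  rewrite (_ : 12 * n = 3 * (4 * n)); last by lia.
  by rewrite !Euclid_dvdM // !negb_or pn !ndvd; lia.
split=> [r r_in|s s_in].
  have -> : 2 * 7 ^ (2 * a + 1) * p ^ (2 * b) * n = 14 * n * (49 ^ a * p ^ (2 * b)).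
    by rewrite S7; ring.
  rewrite -[(11 + 12 * r) * _ * _]mulnA.
  have r5 : 11 + 12 * r = 5 %[mod 6] by lia.
  have := sub5_div6 a b p_prime p_ge5 r5.
  set q := (_ - _) %/ 6 => eq.
  have eN : 2 * (6 * (14 * n * (49 ^ a * p ^ (2 * b)) + q) + 5) =
      p ^ (2 * b) * (49 ^ a * (2 * (84 * n + 11 + 12 * r))).
    by rewrite (mulnDr 6) -addnA eq; ring.
  apply: p77_even_rep; first by move: (S12 a b) eq eN; nia.
  rewrite eN => /(rep21_descent p_prime p_legendre) /rep21_descent49 [x [y e]].
  (* Modulo 7 the equation gives x^2 = 1 + 3r, that is 3, 6 or 5, all non-residues. *)
  have := sqr_mod7 x; move: r_in e; rewrite !inE; set X := x ^ 2; set Y := y ^ 2.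
  lia.
have -> : 2 * 49 ^ (a + 1) * p ^ (2 * b) * n = 98 * n * (49 ^ a * p ^ (2 * b)).
  by rewrite expnD; ring.
have -> : (5 + 12 * s) * 7 ^ (2 * a + 1) * p ^ (2 * b) =
    (35 + 84 * s) * (49 ^ a * p ^ (2 * b)) by rewrite S7; ring.
have s5 : 35 + 84 * s = 5 %[mod 6] by lia.
have := sub5_div6 a b p_prime p_ge5 s5.
set q := (_ - _) %/ 6 => eq.
have eN : 2 * (6 * (98 * n * (49 ^ a * p ^ (2 * b)) + q) + 5) =
    p ^ (2 * b) * (49 ^ a * (14 * (84 * n + 5 + 12 * s))).
  by rewrite (mulnDr 6) -addnA eq; ring.
apply: p77_even_rep; first by move: (S12 a b) eq eN; nia.
rewrite eN => /(rep21_descent p_prime p_legendre) /rep21_descent49 [x [y e]].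
have [x' ex] : exists x', x = 7 * x'.
  by apply: (@dvd7_sqr _ (2 * (84 * n + 5 + 12 * s) - 3 * y ^ 2)); lia.
(* Division by 7 leaves 7x'^2 + 3y^2 = 2(84n + 5 + 12s), so y^2 = 1 + s modulo 7, that is 3, 5 or 6,
   all non-residues. *)
have := sqr_mod7 y; move: s_in e; rewrite ex expnMn !inE.
set X := x' ^ 2; set Y := y ^ 2; lia.
Qed.
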